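(* Suppose that the Kunz polytope $P_{G, m, A, \{r_\alpha\}}$ is admissible. Then there is a bijection $$\rho:\ P_{G, m, A, \{r_\alpha\}} \cap \prod_{\alpha \in A} \mathbb{Z}\ \longrightarrow\ \Sigma,$$ where $\Sigma$ is the set of commutative, cancellative semigroups $S$ such that $\mathsf{gp}(S) = G$, $m \in S$, $A = \pi(\mathrm{Ap}(S;m))$, and there does not exist $s \in S$ infinitely divisible by $m$. Furthermore, if $(x_\alpha)$ is an integer point of $P_{G, m, A, \{r_\alpha\}}$ and $S=\rho(x_\alpha)$, then $\mathrm{Ap}(S;m) = \{ x_\alpha m + r_\alpha \mid \alpha \in A \}$.
   Context: Semigroups are commutative, written additively, and have an identity $0$; $\mathbb{N}$ contains $0$. For a commutative, cancellative semigroup $S$, $\mathsf{gp}(S)=\{a-b\mid a,b\in S\}$ is its group of differences (so $\mathsf{gp}(S)=G$ means $S\subseteq G$ and every element of $G$ is a difference of two elements of $S$). For a subset $X$ of an abelian group, $\langle X\rangle$ denotes the semigroup (with $0$) generated by $X$. $(G,+)$ is an abelian group, $m\in G$ is a nonzero element, $G/\langle m\rangle$ is the quotient of $G$ by the cyclic subgroup generated by $m$, $\pi:G\to G/\langle m\rangle$ is the canonical projection, $A$ is a subsemigroup (containing $0$) of $G/\langle m\rangle$, and for each $\alpha\in A$ an element $r_\alpha\in G$ with $\pi(r_\alpha)=\alpha$ is fixed. For $\alpha,\beta\in A$, $d_{\alpha,\beta}\in\mathbb{Z}$ is the unique integer with $r_\alpha+r_\beta=d_{\alpha,\beta}m+r_{\alpha+\beta}$.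 For a semigroup $S\subseteq G$ containing $m$, the Apéry set is $\mathrm{Ap}(S;m)=\{s\in S\mid s-m\notin S\}$, and $s\in S$ is infinitely divisible by $m$ if $s-pm\in S$ for all $p\in\mathbb{N}$. The Kunz polytope $P_{G,m,A,\{r_\alpha\}}$ is the set of all $(x_\alpha)\in\prod_{\alpha\in A}\mathbb{R}$ such that $x_\alpha+x_\beta+d_{\alpha,\beta}\ge x_{\alpha+\beta}$ for all $\alpha,\beta\in A$. An integer point is a point with all coordinates in $\mathbb{Z}$. The polytope is admissible if there is some integer point $(x_\alpha)$ in it such that $T=\langle\{m\}\cup\{x_\alpha m+r_\alpha\mid\alpha\in A\}\rangle$ satisfies $\mathsf{gp}(T)=G$ and $A=\pi(\mathrm{Ap}(T;m))$, and no element of $T$ is infinitely divisible by $m$.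
   Formalization: The domain of ρ and the ''furthermore'' clause are restricted to integer points with x_0 + d_{0,0} = 0 (i.e. x_0 m + r_0 = 0); without this the claim fails, e.g. G = ℤ, m = 1, A = {0}, r_0 = 0, where the polytope has infinitely many integer points but Σ = {ℕ}. *)

(* Defs.v *)
From HB Require Import structures.
From mathcomp Require Import all_boot all_order all_algebra.
From mathcomp Require Import all_classical all_reals.

Set Implicit Arguments.
Unset Strict Implicit.
Unset Printing Implicit Defensive.

Import Order.TTheory GRing.Theory Num.Theory.

Local Open Scope classical_set_scope.
Local Open Scope ring_scope.

Section Cyclic.
Variables (G : zmodType) (m : G).

Definition cyclic_pred : {pred G} := fun x => `[< exists k : int, x = m *~ k >].

Fact cyclic_pred_zmod_closed : zmod_closed cyclic_pred.
Proof.
split=> [|x y /asboolP[k ->] /asboolP[l ->]]; apply/asboolP.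
  by exists 0; rewrite mulr0z.
by exists (k - l); rewrite mulrzBr.
Qed.

HB.instance Definition _ :=
  GRing.isZmodClosed.Build G cyclic_pred cyclic_pred_zmod_closed.

Definition cyclic_quot : zmodType := Quotient.quot cyclic_pred.

Definition cyclic_proj (x : G) : cyclic_quot := (\pi_(Quotient.quot cyclic_pred) x)%qT.

End Cyclic.

(* A subsemigroup [A] (with 0) of [V], bundled as an [addrClosed V], viewed as
   a type, so that families indexed by [A] are plain functions. *)
Section SubSemigroup.
Variables (V : nmodType) (A : addrClosed V).

Definition elt_of : Type := {a : V | a \in A}.

HB.instance Definition _ := SubChoice.on elt_of.
HB.instance Definition _ :=
  GRing.SubChoice_isSubNmodule.Build V _ elt_of (Algebra.rpred0D A).

End SubSemigroup.

(* Semigroups [S] with gp(S) = G are by convention contained in [G]; they are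
   represented by subsets of [G], hence are commutative and cancellative. *)
Section Semigroups.
Variable G : zmodType.
Implicit Types (S X : set G) (m s : G).

Definition is_subsemigroup S :=
  S 0 /\ forall a b, S a -> S b -> S (a + b).

Definition generated X : set G := smallest is_subsemigroup X.

Definition gp S : set G := [set a - b | a in S & b in S].

Definition Apery S m : set G := [set s | S s /\ ~ S (s - m)].

Definition infinitely_divisible S m s := forall p : nat, S (s - m *+ p).

End Semigroups.

Section Kunz.
Variables (R : realType) (G : zmodType) (m : G).
Variable A : addrClosed (cyclic_quot m).
Variable r : elt_of A -> G.
Implicit Types (x : elt_of A -> R) (S : set G).

(* The integer [k] with [r a + r b = k m + r (a + b)].  It exists when [r] is a
   section of the projection, and is unique when [m] has infinite order, which
   is the case as soon as the polytope is admissible (0 is infinitely divisible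
   by an element of finite order). *)
Definition kunz_d (a b : elt_of A) : int :=
  xget 0 [set k : int | r a + r b = m *~ k + r (a + b)].

Definition kunz_polytope : set (elt_of A -> R) :=
  [set x | forall a b, x a + x b + (kunz_d a b)%:~R >= x (a + b)].

Definition integer_points : set (elt_of A -> R) :=
  [set x | forall a, x a \is a Num.int].

(* On integer points, [x a] is an integer and is equal to its floor. *)
Definition kunz_elt x (a : elt_of A) : G := m *~ Num.floor (x a) + r a.

(* The coordinate at 0 is the one for which [x_0 m + r_0 = 0]; recall that
   [r_0 = d_{0,0} m].  For the usual choice [r_0 = 0] this reads [x_0 = 0].
   The inequalities alone only give [x_0 + d_{0,0} >= 0], while 0 belongs to
   the Apery set of any semigroup in [kunz_semigroups]. *)
Definition normalized_at0 : set (elt_of A -> R) :=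
  [set x | x 0 + (kunz_d 0 0)%:~R = 0].

Definition kunz_conditions S :=
  [/\ gp S = setT,
      [set a | a \in A] = @cyclic_proj G m @` Apery S m
    & ~ exists2 s, S s & infinitely_divisible S m s].

Definition kunz_semigroups : set (set G) :=
  [set S | [/\ is_subsemigroup S, S m & kunz_conditions S]].

Definition admissible :=
  exists2 x, (kunz_polytope `&` integer_points) x
           & kunz_conditions (generated ([set m] `|` range (kunz_elt x))).

End Kunz.

Arguments kunz_polytope R {G m A} r.
Arguments integer_points R {G m} A.
Arguments normalized_at0 R {G m A} r.
Arguments admissible R {G m A} r.
Arguments kunz_semigroups {G m} A.

(* Main.v *)
Require Import Defs.
From mathcomp Require Import all_boot all_order all_algebra.
From mathcomp Require Import all_classical all_reals.
From mathcomp Require Import zify.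

Set Implicit Arguments.
Unset Strict Implicit.
Unset Printing Implicit Defensive.

Import Order.TTheory GRing.Theory Num.Theory.

Local Open Scope classical_set_scope.
Local Open Scope ring_scope.

(* Write w_a = x_a m + r_a.  The bijection sends x to {n m + w_a | n in N, a in A}.
   The Kunz inequalities say exactly that w_a + w_b - w_(a+b) is a nonnegative
   multiple of m, so this set is closed under addition, and the normalization
   says that w_0 = 0.  Admissibility of the polytope provides two facts
   independent of x: m has infinite order, and G is generated by m and
   differences of the r_a.  Conversely, when no element of S is infinitely
   divisible by m, subtracting m as often as possible writes each element of S
   as n m + w with w in Ap(S; m); as Ap(S; m) meets every coset of <m> at most
   once, its elements are of the form x_a m + r_a for a unique x. *)

(** * Cosets of the cyclic subgroup generated by [m] *)

Lemma cyclic_projP (G : zmodType) (m x y : G) :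
  cyclic_proj m x = cyclic_proj m y <-> exists k : int, x = m *~ k + y.
Proof.
have pi_eq : cyclic_proj m x = cyclic_proj m y <-> x - y \in cyclic_pred m.
  by rewrite Quotient.idealrBE; split=> /eqP.
rewrite pi_eq; split=> [/asboolP[k xyE]|[k ->]].
  by exists k; rewrite -xyE subrK.
by rewrite addrK; apply/asboolP; exists k.
Qed.

Lemma cyclic_projD (G : zmodType) (m : G) :
  {morph cyclic_proj m : x y / x + y}.
Proof. by move=> x y; rewrite /cyclic_proj raddfD. Qed.

Lemma cyclic_proj0 (G : zmodType) (m : G) : cyclic_proj m 0 = 0.
Proof. by rewrite /cyclic_proj raddf0. Qed.

Lemma cyclic_projMDl (G : zmodType) (m x : G) (k : int) :
  cyclic_proj m (m *~ k + x) = cyclic_proj m x.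
Proof. by apply/cyclic_projP; exists k. Qed.

(** * Apéry sets of subsemigroups containing [m] *)

Section Subsemigroups.
Variables (G : zmodType) (m : G) (S : set G).
Hypotheses (subS : is_subsemigroup S) (Sm : S m).

Lemma subsemigroup_addMn s n : S s -> S (m *+ n + s).
Proof.
move=> Ss; elim: n => [|n IHn]; first by rewrite mulr0n add0r.
by rewrite mulrS -addrA; apply: subS.2.
Qed.

(** If [k = -(n + 1)], adding [n] copies of [m] to [m *~ k + t] would put [t - m] in [S]. *)
Lemma Apery_minimal t (k : int) : Apery S m t -> S (m *~ k + t) -> 0 <= k.
Proof.
case: k => // n [_ NSt] Skt; exfalso; apply: NSt.
suff -> : t - m = m *+ n + (m *~ Negz n + t) by exact: subsemigroup_addMn.
by rewrite NegzE mulrNz -pmulrn mulrSr opprD !addrA subrr add0r addrC.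
Qed.

Lemma Apery_inj s t : Apery S m s -> Apery S m t ->
  cyclic_proj m s = cyclic_proj m t -> s = t.
Proof.
move=> Aps Apt /cyclic_projP[k sE].
have k_ge0 : 0 <= k by apply: Apery_minimal Apt _; rewrite -sE; case: Aps.
have k_le0 : 0 <= - k.
  by apply: Apery_minimal Aps _; rewrite sE mulrNz addKr; case: Apt.
have k0 : k = 0 by lia.
by rewrite sE k0 mulr0z add0r.
Qed.

Hypothesis ninf : ~ exists2 s, S s & infinitely_divisible S m s.

Lemma Apery_decomposition s : S s -> exists n t, Apery S m t /\ s = m *+ n + t.
Proof.
move=> Ss; have : exists p, ~~ `[< S (s - m *+ p) >].
  apply: contrapT => divs; apply: ninf; exists s => // p.
  by apply: contrapT => NSp; apply: divs; exists p; apply/asboolP.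
(* The least number of subtractions that leaves [S] is positive because [s] is in [S]; one step
   earlier the element is in the Apéry set. *)
move=> /ex_minnP[[|p] /asboolP NSp min_p].
  by case: NSp; rewrite mulr0n subr0.
exists p, (s - m *+ p); split; last by rewrite addrC subrK.
split; last by rewrite -addrA -opprD -mulrSr.
apply: contrapT => NSp'; have : (p < p)%N by apply/min_p/asboolP.
by rewrite ltnn.
Qed.

Lemma Apery0 : Apery S m 0.
Proof.
split; first exact: subS.1.
rewrite sub0r => SNm; apply: ninf; exists 0; first exact: subS.1.
move=> p; rewrite sub0r -mulNrn; elim: p => [|p IHp]; first exact: subS.1.
by rewrite mulrS; apply: subS.2.
Qed.

(** If [m *~ i = m *~ j], then [m *~ (i - j) + 0 = 0] lies in [S], so minimality of the Apéry
    element 0 gives [0 <= i - j]; the situation is symmetric. *)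
Lemma mulrz_inj_of_no_infinitely_divisible : injective (fun k : int => m *~ k).
Proof.
move=> k l /= mkl; have le_of_eq i j : m *~ i = m *~ j -> 0 <= i - j.
  move=> mij; apply: Apery_minimal Apery0 _.
  by rewrite mulrzBr mij subrr addr0; exact: subS.1.
by have := le_of_eq _ _ mkl; have := le_of_eq _ _ (esym mkl); lia.
Qed.

End Subsemigroups.

Lemma elt_ofP (V : nmodType) (A : addrClosed V) (v : V) :
  v \in A -> exists a : elt_of A, val a = v.
Proof. by move=> Av; exists (exist (fun v => v \in A) v Av). Qed.

Lemma generated_subsemigroup (G : zmodType) (X : set G) :
  is_subsemigroup (generated X).
Proof.
split=> [M [[M0 _] _] //|a b Xa Xb M [subM XM]].
by apply: subM.2; [apply: Xa | apply: Xb].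
Qed.

(** * The semigroup attached to a point of the polytope *)

Section KunzSemigroup.
Variables (R : realType) (G : zmodType) (m : G).
Variables (A : addrClosed (cyclic_quot m)) (r : elt_of A -> G).
Hypothesis r_proj : forall a, cyclic_proj m (r a) = val a.
Implicit Types (x : elt_of A -> R) (a b : elt_of A).

(** The default 0 of [xget] is never reached: both sides project to [val (a + b)], so a suitable
    integer exists. *)
Lemma kunz_dP a b : r a + r b = m *~ kunz_d r a b + r (a + b).
Proof.
rewrite /kunz_d; case: xgetP => [k _ //|noK].
have /cyclic_projP[k kE] : cyclic_proj m (r a + r b) = cyclic_proj m (r (a + b)).
  by rewrite cyclic_projD !r_proj.
by case: (noK k).
Qed.

Lemma kunz_eltD x a b :
  kunz_elt r x a + kunz_elt r x b =
  m *~ (Num.floor (x a) + Num.floor (x b) + kunz_d r a b - Num.floor (x (a + b)))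
  + kunz_elt r x (a + b).
Proof.
rewrite /kunz_elt addrACA kunz_dP addrA -!mulrzDr addrA -mulrzDr.
by congr (_ *~ _ + _); lia.
Qed.

Lemma kunz_elt0 x : kunz_elt r x 0 = m *~ (Num.floor (x 0) + kunz_d r 0 0).
Proof.
rewrite mulrzDr; congr (_ + _); apply: (addIr (r 0)).
by rewrite kunz_dP addr0.
Qed.

Lemma kunz_elt_proj x a : cyclic_proj m (kunz_elt r x a) = val a.
Proof. by rewrite cyclic_projMDl r_proj. Qed.

Lemma kunz_elt_projMn x n a :
  cyclic_proj m (m *+ n + kunz_elt r x a) = val a.
Proof. by rewrite pmulrn cyclic_projMDl kunz_elt_proj. Qed.

Lemma generated_proj x t :
  generated ([set m] `|` range (kunz_elt r x)) t -> cyclic_proj m t \in A.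
Proof.
move: t; apply: smallest_sub.
  split=> [|a b Aa Ab] /=; first by rewrite cyclic_proj0 rpred0.
  by rewrite cyclic_projD rpredD.
move=> _ [->|[a _ <-]] /=; last by rewrite kunz_elt_proj; exact: valP.
have -> : cyclic_proj m m = cyclic_proj m 0.
  by apply/cyclic_projP; exists 1; rewrite addr0.
by rewrite cyclic_proj0 rpred0.
Qed.

Lemma admissible_mulrz_inj : admissible R r -> injective (fun k : int => m *~ k).
Proof.
case=> x _ [_ _]; set T := generated _.
apply: mulrz_inj_of_no_infinitely_divisible; first exact: generated_subsemigroup.
by apply: sub_gen_smallest; left.
Qed.

(** The semigroup [T] of the admissible point has gp(T) = G and projects into [A], so each of its
    elements is an integer multiple of [m] plus some [r a]. *)
Lemma admissible_diff (g : G) : admissible R r ->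
  exists (k : int) a b, g = m *~ k + r a - r b.
Proof.
case=> x _ [gpT _ _]; have : setT g by [].
rewrite -gpT => -[s Ts [t Tt <-]].
have decomp u : cyclic_proj m u \in A -> exists (k : int) a, u = m *~ k + r a.
  move=> /elt_ofP[a]; rewrite -r_proj => /esym/cyclic_projP[k uE].
  by exists k, a.
have [k [a ->]] := decomp _ (generated_proj Ts).
have [l [b ->]] := decomp _ (generated_proj Tt).
by exists (k - l), a, b; rewrite mulrzBr opprD addrACA addrA.
Qed.

(** The value of the bijection at [x], given by normal forms rather than generators, so that
    membership yields a coefficient of [m] at once. *)
Definition kunz_semigroup x : set G :=
  [set s | exists (n : nat) a, s = m *+ n + kunz_elt r x a].

Lemma kunz_elt_semigroup x a : kunz_semigroup x (kunz_elt r x a).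
Proof. by exists 0%N, a; rewrite mulr0n add0r. Qed.

Lemma integer_pointsE x : integer_points R A x ->
  x = fun a => (Num.floor (x a))%:~R.
Proof. by move=> intx; apply/funext => a; rewrite floorK. Qed.

Lemma kunz_polytope_floor x : kunz_polytope R r x -> integer_points R A x ->
  forall a b, Num.floor (x (a + b)) <= Num.floor (x a) + Num.floor (x b) + kunz_d r a b.
Proof.
by move=> Px intx a b; rewrite -(ler_int R) !intrD !floorK.
Qed.

Lemma normalized_kunz_elt0 x : integer_points R A x -> normalized_at0 R r x ->
  kunz_elt r x 0 = 0.
Proof.
move=> intx; rewrite /normalized_at0 /= -(floorK (intx 0)) -intrD => /eqP.
by rewrite intr_eq0 kunz_elt0 => /eqP ->; rewrite mulr0z.
Qed.

Lemma kunz_semigroup_subsemigroup x :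
  kunz_polytope R r x -> integer_points R A x -> normalized_at0 R r x ->
  is_subsemigroup (kunz_semigroup x).
Proof.
move=> Px intx x0; split.
  by rewrite -(normalized_kunz_elt0 intx x0); exact: kunz_elt_semigroup.
move=> _ _ [n [a ->]] [p [b ->]]; rewrite addrACA kunz_eltD.
have := kunz_polytope_floor Px intx a b; rewrite -subr_ge0.
(* [q] is the slack in the Kunz inequality for [a] and [b]. *)
case: (_ - _) => // q _; exists (n + p + q)%N, (a + b).
by rewrite -pmulrn addrA -!mulrnDr.
Qed.

(** * Consequences of [m] having infinite order *)

Section TorsionFree.
Hypothesis mulrz_m_inj : injective (fun k : int => m *~ k).

(** The projection determines the index [a]; infinite order of [m] then determines the coefficient,
    which is a natural number. *)
Lemma kunz_semigroup_mem x (k : int) a :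
  kunz_semigroup x (m *~ k + kunz_elt r x a) -> 0 <= k.
Proof.
move=> [n [b eqnb]]; have ab : a = b.
  apply: val_inj; rewrite -(kunz_elt_projMn x n b) -eqnb.
  by rewrite cyclic_projMDl kunz_elt_proj.
by move: eqnb; rewrite ab => /addIr; rewrite pmulrn => /mulrz_m_inj ->.
Qed.

Lemma kunz_semigroup_Apery x :
  Apery (kunz_semigroup x) m = range (kunz_elt r x).
Proof.
apply/seteqP; split=> [_ [[[|n] [a ->]] NS]|_ [a _ <-]].
- by exists a; rewrite // mulr0n add0r.
- by case: NS; exists n, a; rewrite mulrSr addrAC addrK.
split; first exact: kunz_elt_semigroup.
by rewrite addrC -mulrN1z => /kunz_semigroup_mem.
Qed.

Lemma kunz_semigroup_no_infinitely_divisible x :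
  ~ exists2 s, kunz_semigroup x s & infinitely_divisible (kunz_semigroup x) m s.
Proof.
move=> [_ [n [a ->]] /(_ n.+1)].
rewrite addrAC mulrSr opprD addNKr -mulrN1z.
by move=> /kunz_semigroup_mem.
Qed.

Lemma kunz_semigroup_gp x : (forall g, exists (k : int) a b, g = m *~ k + r a - r b) ->
  gp (kunz_semigroup x) = setT.
Proof.
move=> diff; apply/seteqP; split=> // g _; have [k [a [b ->]]] := diff g.
set l : int := k - Num.floor (x a) + Num.floor (x b).
have -> : m *~ k + r a - r b = m *~ l + kunz_elt r x a - kunz_elt r x b.
  rewrite -addrA /kunz_elt [_ *~ l + _]addrA -mulrzDr opprD addrACA -mulrzBr.
  by congr (_ *~ _ + _); rewrite /l; lia.
(* Coefficients must be natural numbers, so [l] goes to the minuend if nonnegative, and its opposite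
   to the subtrahend otherwise. *)
case: l => n.
  exists (m *+ n + kunz_elt r x a); first by exists n, a.
  by exists (kunz_elt r x b) => //; exact: kunz_elt_semigroup.
exists (kunz_elt r x a); first exact: kunz_elt_semigroup.
exists (m *+ n.+1 + kunz_elt r x b); first by exists n.+1, b.
by rewrite NegzE mulrNz opprD addrA [- _ + _]addrC.
Qed.

Lemma kunz_semigroup_inj x y : integer_points R A x -> integer_points R A y ->
  kunz_semigroup x = kunz_semigroup y -> x = y.
Proof.
move=> intx inty eqxy; rewrite (integer_pointsE intx) (integer_pointsE inty).
(* Stated for arbitrary points so that swapping them gives both inequalities. *)
have le_floor_of x' y' a : kunz_semigroup x' = kunz_semigroup y' ->
    Num.floor (y' a) <= Num.floor (x' a).
  move=> eqxy'; have := kunz_elt_semigroup x' a; rewrite eqxy'.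
  have -> : kunz_elt r x' a =
      m *~ (Num.floor (x' a) - Num.floor (y' a)) + kunz_elt r y' a.
    by rewrite /kunz_elt addrA -mulrzDr subrK.
  by move/kunz_semigroup_mem; rewrite subr_ge0.
by apply/funext => a; congr (_%:~R); apply/eqP; rewrite eq_le !le_floor_of.
Qed.

Lemma kunz_semigroup_surj S : kunz_semigroups A S ->
  exists2 x, (kunz_polytope R r `&` integer_points R A `&` normalized_at0 R r) x
           & kunz_semigroup x = S.
Proof.
move=> [subS Sm [_ projS ninf]].
have coord a : exists k : int, Apery S m (m *~ k + r a).
  have : [set a | a \in A] (val a) by exact: valP.
  rewrite projS => -[s Aps]; rewrite -r_proj => /cyclic_projP[k sE].
  by exists k; rewrite -sE.
have [X ApX] := choice coord.
pose x a : R := (X a)%:~R.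
have floorx a : Num.floor (x a) = X a by rewrite /x intrKfloor.
have Apx a : Apery S m (kunz_elt r x a) by rewrite /kunz_elt floorx.
have kunz_elt0E : kunz_elt r x 0 = 0.
  by apply: (Apery_inj subS Sm) (Apx 0) (Apery0 subS ninf) _; rewrite kunz_elt_proj cyclic_proj0.
exists x; last first.
  apply/seteqP; split=> [_ [n [a ->]]|s Ss].
    by apply: subsemigroup_addMn => //; case: (Apx a).
  have [n [t [Apt ->]]] := Apery_decomposition ninf Ss.
  have /elt_ofP[a aE] : cyclic_proj m t \in A.
    have : (cyclic_proj m @` Apery S m) (cyclic_proj m t) by exists t.
    by rewrite -projS.
  exists n, a; congr (_ + _).
  by apply: (Apery_inj subS Sm) Apt (Apx _) _; rewrite kunz_elt_proj.
split; first split.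
(* The slack is the coefficient of [m] in [w_a + w_b - w_(a+b)]; it is nonnegative by minimality of
   the Apéry element [w_(a+b)]. *)
- move=> a b; rewrite /x -!intrD ler_int -subr_ge0 -!floorx.
  apply: (Apery_minimal subS Sm (Apx (a + b))); rewrite -kunz_eltD.
  by apply: subS.2; [case: (Apx a) | case: (Apx b)].
- by move=> a; rewrite /x intr_int.
have := kunz_elt0E; rewrite kunz_elt0 floorx -(mulr0z m) => /mulrz_m_inj X0.
by rewrite /normalized_at0 /= /x -intrD X0.
Qed.

End TorsionFree.

End KunzSemigroup.

Theorem proposition3p6 (R : realType) (G : zmodType) (m : G) (m_neq0 : m != 0)
    (A : addrClosed (cyclic_quot m)) (r : elt_of A -> G)
    (r_proj : forall a : elt_of A, cyclic_proj m (r a) = val a) :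
  admissible R r ->
  exists rho : (elt_of A -> R) -> set G,
    set_bij (kunz_polytope R r `&` integer_points R A `&` normalized_at0 R r)
            (kunz_semigroups A) rho /\
    forall x : elt_of A -> R,
      (kunz_polytope R r `&` integer_points R A `&` normalized_at0 R r) x ->
      Apery (rho x) m = [set m *~ Num.floor (x a) + r a | a in setT].
Proof.
move=> adm; have m_inj := admissible_mulrz_inj adm.
exists (kunz_semigroup r); split; last first.
  by move=> x _; exact: kunz_semigroup_Apery.
split.
- move=> x [[Px intx] x0]; have subS := kunz_semigroup_subsemigroup r_proj Px intx x0.
  split=> //.
    (* As [w_0 = 0], [m] is [1 m + w_0]. *)
    by exists 1%N, 0; rewrite (normalized_kunz_elt0 r_proj intx x0) addr0.
  split.
  + by apply: kunz_semigroup_gp => g; exact: admissible_diff r_proj _ adm.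
  + rewrite kunz_semigroup_Apery //; apply/seteqP; split.
      move=> _ /elt_ofP[a <-]; exists (kunz_elt r x a); first by exists a.
      by rewrite kunz_elt_proj.
    by move=> _ [_ [a _ <-] <-] /=; rewrite kunz_elt_proj //; exact: valP.
  + exact: kunz_semigroup_no_infinitely_divisible.
- by move=> x y /set_mem[[_ intx] _] /set_mem[[_ inty] _]; exact: kunz_semigroup_inj.
- by move=> S /(kunz_semigroup_surj R r_proj m_inj)[x xP <-]; exists x.
Qed.
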